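(* Let $\mathcal R\subseteq P$ be closed under rotation. Then $\mathcal R$ is a skew category of partitions if and only if $F_\infty(\mathcal R)$ is an ($\mathrm S_\infty$-invariant) normal subgroup of $\mathbb Z_2^{*\infty}$ and $$\mathcal R=\{p\mid p\text{ is a rotation of }\ker(\mathbf i)\text{ for some }k\in\mathbb N_0,\ \mathbf i\in\mathbb N^k\text{ with }a_{\mathbf i}\in F_\infty(\mathcal R)\}.$$ In particular, for any $\mathrm S_\infty$-invariant normal subgroup $N\unlhd\mathbb Z_2^{*\infty}$ the set $$\{p\mid p\text{ is a rotation of }\ker(\mathbf i)\text{ for some }k\in\mathbb N_0,\ \mathbf i\in\mathbb N^k\text{ with }a_{\mathbf i}\in N\}$$ is a skew category of partitions.
   Context: Partitions. $\mathbb N=\{1,2,\dots\}$, $\mathbb N_0=\mathbb N\cup\{0\}$. For $k,l\in\mathbb N_0$, $P(k,l)$ is the set of all set partitions of $\{1,\dots,k,1',\dots,l'\}$ (with $k$ upper points $1,\dots,k$ and $l$ lower points $1',\dots,l'$), and $P=\bigcup_{k,l}P(k,l)$. For $D\subseteq P$ put $D(k,l)=D\cap P(k,l)$. For $\mathbf i\in\mathbb N^k,\mathbf j\in\mathbb N^l$, $\ker(\mathbf i,\mathbf j)\in P(k,l)$ is the partition in which two points lie in the same block iff they carry the same label, where upper point $x$ carries $i_x$ and lower point $y'$ carries $j_y$; $\ker(\mathbf i):=\ker(\mathbf i,\emptyset)\in P(k,0)$. For $p\in P(k,l)$, $\mathrm{ind}(p)=(\mathbf i^{(p)},\mathbf j^{(p)})\in\mathbb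 N^k\times\mathbb N^l$ is the lexicographically minimal pair with $\ker(\mathrm{ind}(p))=p$. $\mathrm S_\infty$ is the group of bijections $\mathbb N\to\mathbb N$ moving only finitely many points; it acts componentwise on multi-indices, and $\mathrm S_\infty(x)$ denotes the orbit of $x$ (for a set $X$, $\mathrm S_\infty(X)$ is the union of the orbits). Thus $(\mathbf i,\mathbf j)\in \mathrm S_\infty(\mathrm{ind}(p))$ iff $\ker(\mathbf i,\mathbf j)=p$. Juxtaposition of multi-indices is concatenation. Rotation. A basic rotation of $p$ moves the leftmost upper point to the left end of the lower row, or the leftmost lower point to the left end of the upper row, or the rightmost upper point to the right end of the lower row, or the rightmost lower point to the right end of the upper row, keeping block membership. A rotation of $p$ is the result of a finite (possibly empty) sequence of basic rotations. Operations. Let $p\in P(k,l)$, $q\in P(k',l')$. The involution $p^*\in P(l,k)$ is $p$ turned upside-down. A connected tensor product of $p$ and $q$ is any $\ker(\mathbf{if},\mathbf{jg})\in P(k+k',l+l')$ with $(\mathbf i,\mathbf j)\in \mathrm S_\infty(\mathrm{ind}(p))$, $(\mathbf f,\mathbf g)\in \mathrm S_\infty(\mathrm{ind}(q))$. If $l=k'$, $p$ and $q$ are compatible if $\mathbf j^{(p)}\in \mathrm S_\infty(\mathbf i^{(q)})$. In this case the conditioned composition is the usual composition $qp\in P(k,l')$: place $p$ above $q$, identify the lower points of $p$ with the upper points of $q$, merge blocks accordingly, and restrict to the upper points of $p$ and lower points of $q$. A skew category of partitions is a subset of $P$ containing $\sqcup:=\ker((1,1),\emptyset)$ and $|:=\ker((1),(1))$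 and closed under involution, connected tensor products and conditioned composition of compatible partitions. Free product. $\mathbb Z_2^{*\infty}=\langle a_i\ (i\in\mathbb N)\mid a_i^2=1\rangle$; for $\mathbf i=(i_1,\dots,i_k)\in\mathbb N^k$, $a_{\mathbf i}=a_{i_1}\cdots a_{i_k}$. $\mathrm S_\infty$ acts on $\mathbb Z_2^{*\infty}$ by $\sigma(a_{\mathbf i})=a_{\sigma(\mathbf i)}$. For $D\subseteq P$ closed under rotation, $F_\infty(D):=\mathrm S_\infty(\{a_{\mathrm{ind}(p)}\mid k\in\mathbb N_0,\ p\in D(k,0)\})\subseteq\mathbb Z_2^{*\infty}$. *)

(* Defs.v *)
(* Mathematical Components, with the classical layer of MathComp-Analysis. *)
From HB Require Import structures.
From mathcomp Require Import boolp classical_sets cardinality.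
(* Imported last, so that [partition] is the one on finite sets. *)
From mathcomp Require Import all_boot all_order generic_quotient.

Set Implicit Arguments.
Unset Strict Implicit.
Unset Printing Implicit Defensive.

Local Open Scope quotient_scope.

(* The upper points of P(k,l) are inl x, the lower ones inr y. *)
Notation points k l := ('I_k + 'I_l)%type.

Definition part (k l : nat) : Type :=
  {p : {set {set points k l}} | partition p [set: points k l]%SET}.

(* A subset D of P, given by its slices D(k,l). *)
Definition partset : Type := forall k l : nat, set (part k l).

Definition same_block k l (p : part k l) : rel (points k l) :=
  fun u v => v \in pblock (val p) u.

(* The label set {1, 2, ...} is encoded by nat = {0, 1, ...}, via n |-> n - 1,
   which preserves the order of labels.  A pair in N^k x N^l is an [mindex]. *)
Definition mindex (k l : nat) : Type := (k.-tuple nat * l.-tuple nat)%type.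

Definition label k l (ij : mindex k l) (u : points k l) : nat :=
  match u with inl x => tnth ij.1 x | inr y => tnth ij.2 y end.

Definition ker k l (i : k.-tuple nat) (j : l.-tuple nat) : part k l :=
  exist _ (preim_partition (label (i, j)) [set: points k l]%SET)
          (preim_partitionP (label (i, j)) [set: points k l]%SET).

Definition is_Sinf (s : nat -> nat) : Prop :=
  bijective s /\ finite_set [set n | s n <> n]%classic.

Definition relabel (s : nat -> nat) k l (ij : mindex k l) : mindex k l :=
  (map_tuple s ij.1, map_tuple s ij.2).

Definition mindex_orbit k l (ij : mindex k l) : set (mindex k l) :=
  fun ij' => exists2 s, is_Sinf s & ij' = relabel s ij.

(* Lexicographic comparison of pairs; the lengths k and l being fixed, this is
   lexicographic comparison of the concatenations. *)
Definition mindex_le k l (ij ij' : mindex k l) : bool :=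
  Order.le (ij.1 ++ ij.2 : seqlexi nat) (ij'.1 ++ ij'.2 : seqlexi nat).

Definition is_ind k l (p : part k l) (ij : mindex k l) : Prop :=
  ker ij.1 ij.2 = p /\
  forall ij' : mindex k l, ker ij'.1 ij'.2 = p -> mindex_le ij ij'.

Lemma tuple_lexi_min n (A : n.-tuple nat -> Prop) :
  (exists t, A t) ->
  exists2 t, A t & forall t', A t' -> Order.le (val t : seqlexi nat) (val t').
Proof.
elim: n A => [|n IHn] A.
  by case=> t At; exists t => // t' _; rewrite (tuple0 t) (tuple0 t').
case=> t0 At0.
pose H m := `[< exists t : n.-tuple nat, A [tuple of m :: t] >].
have exH : exists m, H m.
  by exists (thead t0); apply/asboolP; exists [tuple of behead t0]; rewrite -tuple_eta.
have [m /asboolP exm minm] := ex_minnP exH.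
have [t At mint] := IHn _ exm.
exists [tuple of m :: t] => // t' At'.
have Ht' : H (thead t').
  by apply/asboolP; exists [tuple of behead t']; rewrite -tuple_eta.
have le_m := minm _ Ht'.
move: At' Ht' le_m; case/tupleP: t' => m' t'' At' _.
rewrite theadE /= => le_m; rewrite lexi_cons !leEnat le_m /=.
apply/implyP => le_m'.
have em : m = m' by apply/eqP; rewrite eqn_leq le_m le_m'.
by apply: mint; rewrite em.
Qed.

Lemma ind_exists k l (p : part k l) : exists ij, is_ind p ij.
Proof.
pose split_mi (t : (k + l).-tuple nat) : mindex k l :=
  ([tuple tnth t (lshift l x) | x < k], [tuple tnth t (rshift k y) | y < l]).
have splitK t : (split_mi t).1 ++ (split_mi t).2 = t :> seq nat.
  have -> : (split_mi t).1 ++ (split_mi t).2 =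
            [tuple of (split_mi t).1 ++ (split_mi t).2] :> seq nat by [].
  congr val; apply: eq_from_tnth => z.
  by case: (split_ordP z) => x ->; rewrite ?tnth_lshift ?tnth_rshift tnth_mktuple.
have catK (ij : mindex k l) : split_mi [tuple of ij.1 ++ ij.2] = ij.
  case: ij => i j; congr pair; apply: eq_from_tnth => x;
  by rewrite tnth_mktuple ?tnth_lshift ?tnth_rshift.
pose A t := ker (split_mi t).1 (split_mi t).2 = p.
have exA : exists t, A t.
  pose f u := index (pblock (val p) u) (enum (val p)).
  exists [tuple of [tuple f (inl x) | x < k] ++ [tuple f (inr y) | y < l]].
  rewrite /A; set t := [tuple of _].
  have -> : split_mi t =
     ([tuple f (inl x) | x < k], [tuple f (inr y) | y < l]) by apply: (catK (_, _)).
  apply: val_inj => /=.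
  rewrite -[RHS](preim_partition_pblock (valP p)) /preim_partition.
  have [/eqP covp _ _] := and3P (valP p).
  have inp u : pblock (val p) u \in enum (val p).
    by rewrite mem_enum pblock_mem // covp finset.in_setT.
  rewrite /equivalence_partition; apply: eq_imset => u; apply/setP => v.
  rewrite !inE /=.
  have lab w : label ([tuple f (inl x) | x < k], [tuple f (inr y) | y < l]) w = f w.
    by case: w => w; rewrite /= tnth_mktuple.
  rewrite !lab /f; apply/eqP/eqP => [|-> //].
  by move=> /(congr1 (nth finset.set0 (enum (val p)))); rewrite !nth_index.
have [t At mint] := tuple_lexi_min exA.
exists (split_mi t); split=> // ij' kij'; rewrite /mindex_le splitK.
by apply: (mint [tuple of ij'.1 ++ ij'.2]); rewrite /A catK.
Qed.

Definition ind k l (p : part k l) : mindex k l := sval (cid (ind_exists p)).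

Lemma indP k l (p : part k l) : is_ind p (ind p).
Proof. exact: svalP. Qed.

(* Renaming the points of a partition along a bijection. *)
Lemma image_part_subproof k l k' l' (h : points k l -> points k' l')
    (hbij : bijective h) (p : part k l) :
  partition [set h @: (B : {set points k l}) | B in val p]%SET [set: points k' l']%SET.
Proof.
have <- : (h @: [set: points k l])%SET = [set: points k' l']%SET.
  case: hbij => g _ gK; apply/setP => u; rewrite finset.in_setT; apply/imsetP.
  by exists (g u); rewrite ?gK.
by rewrite imset_partition ?(valP p) //; apply: bij_inj.
Qed.

Definition image_part k l k' l' (h : points k l -> points k' l')
    (hbij : bijective h) (p : part k l) : part k' l' :=
  exist _ [set h @: (B : {set points k l}) | B in val p]%SET
          (image_part_subproof hbij p).

Definition flip k l (u : points k l) : points l k :=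
  match u with inl x => inr x | inr y => inl y end.

Lemma flip_bij k l : bijective (@flip k l).
Proof. by exists (@flip l k); case. Qed.

Definition invol k l (p : part k l) : part l k := image_part (@flip_bij k l) p.

(* The upper point at position [a] becomes the lower point at position [b]; the
   other points keep their order within their row.  Only a = b = ord0 (leftmost)
   and a = b = ord_max (rightmost) are used. *)
Definition down k l (a : 'I_k.+1) (b : 'I_l.+1) (u : points k.+1 l) :
    points k l.+1 :=
  match u with
  | inl x => if unlift a x is Some x' then inl x' else inr b
  | inr y => inr (lift b y)
  end.

Definition up k l (a : 'I_k.+1) (b : 'I_l.+1) (u : points k l.+1) :
    points k.+1 l :=
  match u with
  | inl x => inl (lift a x)
  | inr y => if unlift b y is Some y' then inr y' else inl a
  end.

Lemma downK k l (a : 'I_k.+1) (b : 'I_l.+1) : cancel (down a b) (up a b).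
Proof.
case=> [x|y] /=; last by rewrite liftK.
by case: unliftP => [x' ->|->] //=; rewrite unlift_none.
Qed.

Lemma upK k l (a : 'I_k.+1) (b : 'I_l.+1) : cancel (up a b) (down a b).
Proof.
case=> [x|y] /=; first by rewrite liftK.
by case: unliftP => [y' ->|->] //=; rewrite unlift_none.
Qed.

Lemma down_bij k l (a : 'I_k.+1) (b : 'I_l.+1) : bijective (down a b).
Proof. exact: Bijective (downK a b) (upK a b). Qed.

Lemma up_bij k l (a : 'I_k.+1) (b : 'I_l.+1) : bijective (up a b).
Proof. exact: Bijective (upK a b) (downK a b). Qed.

Inductive basic_rotation :
    forall k l, part k l -> forall k' l', part k' l' -> Prop :=
| Rot_down_left k l (p : part k.+1 l) :
    basic_rotation p (image_part (down_bij (@ord0 k) (@ord0 l)) p)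
| Rot_up_left k l (p : part k l.+1) :
    basic_rotation p (image_part (up_bij (@ord0 k) (@ord0 l)) p)
| Rot_down_right k l (p : part k.+1 l) :
    basic_rotation p (image_part (down_bij (@ord_max k) (@ord_max l)) p)
| Rot_up_right k l (p : part k l.+1) :
    basic_rotation p (image_part (up_bij (@ord_max k) (@ord_max l)) p).

(* [rotation p r] : r is a rotation of p. *)
Inductive rotation k l (p : part k l) :
    forall k' l', part k' l' -> Prop :=
| Rotation_refl : rotation p p
| Rotation_step k1 l1 (q : part k1 l1) k2 l2 (r : part k2 l2) :
    rotation p q -> basic_rotation q r -> rotation p r.

Definition rotation_closed (D : partset) : Prop :=
  forall k l (p : part k l) k' l' (r : part k' l'),
    D k l p -> rotation p r -> D k' l' r.

Definition connected_tensor k l k' l' (p : part k l) (q : part k' l')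
    (r : part (k + k') (l + l')) : Prop :=
  exists (ij : mindex k l) (fg : mindex k' l'),
    [/\ mindex_orbit (ind p) ij, mindex_orbit (ind q) fg
      & r = ker (cat_tuple ij.1 fg.1) (cat_tuple ij.2 fg.2)].

Definition compatible k l m (p : part k l) (q : part l m) : Prop :=
  exists2 s, is_Sinf s & (ind p).2 = map_tuple s (ind q).1.

(* The three rows of points obtained by placing p above q: the points of p,
   whose lower row is identified with the upper row of q, and the lower points
   of q. *)
Notation stack k l m := ('I_k + 'I_l + 'I_m)%type.

Definition stack_top k l m (u : points k l) : stack k l m := inl u.

Definition stack_bot k l m (v : points l m) : stack k l m :=
  match v with inl y => inl (inr y) | inr z => inr z end.

Definition stack_outer k l m (w : points k m) : stack k l m :=
  match w with inl x => inl (inl x) | inr z => inr z end.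

Definition stack_edge k l m (p : part k l) (q : part l m) :
    rel (stack k l m) :=
  fun w w' =>
    [exists u, exists v, [&& same_block p u v, stack_top m u == w
                           & stack_top m v == w']]
    || [exists u, exists v, [&& same_block q u v, stack_bot k u == w
                              & stack_bot k v == w']].

Definition comp_rel k l m (p : part k l) (q : part l m) : rel (points k m) :=
  fun u v =>
    connect (stack_edge p q) (stack_outer l u) (stack_outer l v).

Lemma same_block_sym k l (p : part k l) : symmetric (same_block p).
Proof.
move=> u v; rewrite /same_block.
have h := pblock_equivalence (valP p).
have e1 := h u v u (finset.in_setT _) (finset.in_setT _) (finset.in_setT _).
have e2 := h v u v (finset.in_setT _) (finset.in_setT _) (finset.in_setT _).
apply/idP/idP => H.
  by rewrite -(e1.2 H) e1.1.
by rewrite -(e2.2 H) e2.1.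
Qed.

Lemma stack_edge_sym k l m (p : part k l) (q : part l m) :
  symmetric (stack_edge p q).
Proof.
move=> w w'; rewrite /stack_edge.
by congr (_ || _); apply/existsP/existsP => -[u /existsP [v /and3P [uv uw vw]]];
  exists v; apply/existsP; exists u; rewrite same_block_sym uv vw uw.
Qed.

Lemma comp_rel_equiv k l m (p : part k l) (q : part l m) :
  {in [set: points k m]%SET & &, equivalence_rel (comp_rel p q)}.
Proof.
move=> u v w _ _ _; split; first exact: connect0.
have csym := sym_connect_sym (stack_edge_sym p q).
by move=> uv; apply: (same_connect csym).
Qed.

(* The composition qp (p above q). *)
Definition comp k l m (p : part k l) (q : part l m) : part k m :=
  exist _ (equivalence_partition (comp_rel p q) [set: points k m]%SET)
          (equivalence_partitionP (@comp_rel_equiv k l m p q)).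

Definition pcup : part 2 0 := ker [tuple 1; 1] [tuple].
Definition pid : part 1 1 := ker [tuple 1] [tuple 1].

Definition skew_category (D : partset) : Prop :=
  [/\ D 2 0 pcup /\ D 1 1 pid,
      forall k l (p : part k l), D k l p -> D l k (invol p),
      forall k l k' l' (p : part k l) (q : part k' l')
             (r : part (k + k') (l + l')),
        D k l p -> D k' l' q -> connected_tensor p q r ->
        D (k + k') (l + l') r
    & forall k l m (p : part k l) (q : part l m),
        D k l p -> D l m q -> compatible p q -> D k m (comp p q)].

(* Since the relators a_i^2 make every generator its own inverse, the presented
   group is the quotient of the free monoid on the generators by the smallest
   congruence identifying each square a_i a_i with the empty word. *)
Inductive word_eq : seq nat -> seq nat -> Prop :=
| Word_square i : word_eq [:: i; i] [::]
| Word_cat u u' v v' :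
    word_eq u u' -> word_eq v v' -> word_eq (u ++ v) (u' ++ v')
| Word_refl u : word_eq u u
| Word_sym u v : word_eq u v -> word_eq v u
| Word_trans u v w : word_eq u v -> word_eq v w -> word_eq u w.

Definition word_eqb : rel (seq nat) := fun u v => `[< word_eq u v >].

Lemma word_eqb_refl : reflexive word_eqb.
Proof. by move=> u; apply/asboolP/Word_refl. Qed.

Lemma word_eqb_sym : symmetric word_eqb.
Proof. by move=> u v; apply/asboolP/asboolP => /Word_sym. Qed.

Lemma word_eqb_trans : transitive word_eqb.
Proof.
by move=> v u w /asboolP uv /asboolP vw; apply/asboolP/(Word_trans uv vw).
Qed.

Canonical word_equiv :=
  EquivRel word_eqb word_eqb_refl word_eqb_sym word_eqb_trans.

(* The free product of countably many copies of Z/2Z. *)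
Definition Z2free : Type := {eq_quot word_eqb}.

HB.instance Definition _ := Choice.on Z2free.
HB.instance Definition _ := EqQuotient.on Z2free.

(* The element a_w = a_{w_1} ... a_{w_k}. *)
Definition aword (w : seq nat) : Z2free := \pi_Z2free w.

Lemma awordP u v : aword u = aword v <-> word_eq u v.
Proof. by split=> [/eqquotP/asboolP|uv]; last exact/eqquotP/asboolP. Qed.

Lemma awordK x : aword (repr x) = x.
Proof. exact: reprK. Qed.

Lemma repr_aword w : word_eq (repr (aword w)) w.
Proof. by apply/awordP/awordK. Qed.

Definition Z2mul (x y : Z2free) : Z2free := aword (repr x ++ repr y).
Definition Z2inv (x : Z2free) : Z2free := aword (rev (repr x)).

Lemma Z2mulE u v : Z2mul (aword u) (aword v) = aword (u ++ v).
Proof. by apply/awordP/Word_cat; apply: repr_aword. Qed.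

Lemma word_eq_rev u v : word_eq u v -> word_eq (rev u) (rev v).
Proof.
elim=> {u v} [i|u u' v v' _ IHu _ IHv|u|u v _|u v w _ uv _]; first exact: Word_square.
- by rewrite !rev_cat; apply: Word_cat.
- exact: Word_refl.
- exact: Word_sym.
- exact: Word_trans uv.
Qed.

Lemma Z2invE u : Z2inv (aword u) = aword (rev u).
Proof. by apply/awordP/word_eq_rev/repr_aword. Qed.

Lemma word_eq_revl w : word_eq (rev w ++ w) [::].
Proof.
elim: w => [|i w IHw]; first exact: Word_refl.
rewrite rev_cons cat_rcons; apply: (Word_trans _ IHw).
apply: Word_cat; first exact: Word_refl.
by apply: (@Word_cat [:: i; i] [::]); [apply: Word_square | apply: Word_refl].
Qed.

Lemma Z2mulA : associative Z2mul.
Proof.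
move=> x y z; rewrite -(awordK x) -(awordK y) -(awordK z).
by rewrite !Z2mulE catA.
Qed.

Lemma Z2mul1 : left_id (aword [::]) Z2mul.
Proof. by move=> x; rewrite -(awordK x) Z2mulE. Qed.

Lemma Z2mulr1 : right_id (aword [::]) Z2mul.
Proof. by move=> x; rewrite -(awordK x) Z2mulE cats0. Qed.

Lemma Z2mulV : left_inverse (aword [::]) Z2inv Z2mul.
Proof.
by move=> x; rewrite -(awordK x) Z2invE Z2mulE; apply/awordP/word_eq_revl.
Qed.

Lemma Z2mulrV : right_inverse (aword [::]) Z2inv Z2mul.
Proof.
move=> x; rewrite -(awordK x) Z2invE Z2mulE; apply/awordP.
by have := word_eq_revl (rev (repr x)); rewrite revK.
Qed.

HB.instance Definition _ :=
  isGroup.Build Z2free Z2mulA Z2mul1 Z2mulr1 Z2mulV Z2mulrV.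

Definition Sact (s : nat -> nat) (x : Z2free) : Z2free :=
  aword (map s (repr x)).

Lemma word_eq_map s u v : word_eq u v -> word_eq (map s u) (map s v).
Proof.
elim=> {u v} [i|u u' v v' _ IHu _ IHv|u|u v _|u v w _ uv _]; first exact: Word_square.
- by rewrite !map_cat; apply: Word_cat.
- exact: Word_refl.
- exact: Word_sym.
- exact: Word_trans uv.
Qed.

Lemma Sact_aword s w : Sact s (aword w) = aword (map s w).
Proof. exact/awordP/word_eq_map/repr_aword. Qed.

Definition Sorbit (X : set Z2free) : set Z2free :=
  fun y => exists2 s, is_Sinf s & exists2 x, X x & y = Sact s x.

Definition Sinvariant (X : set Z2free) : Prop :=
  forall s x, is_Sinf s -> X x -> X (Sact s x).

Definition normal_subgroup (N : set Z2free) : Prop :=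
  group_closed [in N] /\ (forall x y : Z2free, N x -> N (x ^ y)%g).

Definition Finf (D : partset) : set Z2free :=
  Sorbit (fun x => exists k (p : part k 0), D k 0 p /\ x = aword (ind p).1).

(* The partitions that are rotations of some ker(i) with a_i in N. *)
Definition rotations_of (N : set Z2free) : partset :=
  fun k l p => exists n (i : n.-tuple nat),
    N (aword i) /\ rotation (ker i [tuple]) p.
Arguments rotations_of : clear implicits.

(* Main.v *)
Require Import Defs.
From mathcomp Require Import boolp classical_sets cardinality.
From mathcomp Require Import all_boot.

(** The partition ker(i, j) is determined by the word read around its
    boundary, a_{rev j ++ i}, up to renaming of letters, together with the way
    the word is cut into two rows.  Each basic rotation moves the cut, which
    changes the boundary word by a cyclic shift at most.  A rotation-closed R
    is therefore the same thing as a set L of words, closed under renaming and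
    cyclic shifts: ker(i, j) lies in R exactly when rev j ++ i lies in L
    ([rotation_closed_kerE]).

    Under this dictionary the skew category operations are group operations.
    Writing x = (a_j)^-1 a_i for the element of the boundary word of p =
    ker(i, j), the involution gives x^-1.  A connected tensor product of p with
    q = ker(f, g), y = (a_g)^-1 a_f, gives
      (a_j a_g)^-1 (a_i a_f) = (x ^ a_g) y,
    where ^ denotes conjugation.  The composition of ker(i, j) above ker(j, n)
    gives ((a_n)^-1 a_j) ((a_j)^-1 a_i) = (a_n)^-1 a_i, provided that the labels
    common to i and n all occur in j ([comp_ker]); compatibility is exactly what
    allows such a choice of labels ([compatible_labels], [compatible_ker]).
    Hence an invariant normal subgroup N yields a skew category
    ([rotations_of_skew]), once it is known that the boundary word of every
    rotation of a ker(i) with a_i in N again represents an element of N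
    ([rotations_of_kerE]): cyclic shifts are conjugations, and renamings of
    finitely many letters extend to S_infinity ([Sinf_extend]).

    Conversely, let R be a skew category.  Tensor products and involution make L
    closed under concatenation and reversal.  The point is that L is a union of
    classes of equal elements of the free product ([row_word_eq]), that is, that
    a square aa may be inserted and deleted anywhere.  Insertion is a tensor
    product with the pair partition, up to cyclic shift.  It shows in particular
    that L contains every palindrome rev w ++ w, and deletion is composition
    with a partition whose boundary word is such a palindrome with aa inserted
    ([row_word_delete]).  So L is the preimage of Finf R under w |-> a_w, and
    Finf R is an invariant normal subgroup from which R is recovered. *)

Set Implicit Arguments.
Unset Strict Implicit.
Unset Printing Implicit Defensive.

(** * Partitions as kernels of labellings *)

Lemma part_ext k l (p q : part k l) : same_block p =2 same_block q -> p = q.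
Proof.
move=> epq; apply: val_inj => /=.
rewrite -(preim_partition_pblock (valP p)) -(preim_partition_pblock (valP q)).
have [covp trp _] := and3P (valP p); have [covq trq _] := and3P (valP q).
rewrite /preim_partition /equivalence_partition; apply: eq_imset => u.
apply/setP => v; rewrite !inE /= !eq_pblock ?(eqP covp) ?(eqP covq) ?inE //.
exact: epq.
Qed.

Lemma same_block_ker k l (ij : mindex k l) u v :
  same_block (ker ij.1 ij.2) u v = (label ij u == label ij v).
Proof.
case: ij => i j; rewrite /same_block /= /preim_partition.
rewrite pblock_equivalence_partition ?inE //.
by move=> x y z _ _ _; split=> // /eqP->.
Qed.

Lemma ker_eqP k l (ij ij' : mindex k l) :
  ker ij.1 ij.2 = ker ij'.1 ij'.2 <->
  forall u v, (label ij u == label ij v) = (label ij' u == label ij' v).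
Proof.
split=> [e u v|e]; first by rewrite -!same_block_ker e.
by apply: part_ext => u v; rewrite !same_block_ker.
Qed.

Lemma image_part_ker k l k' l' (h : points k l -> points k' l')
    (hbij : bijective h) (ij : mindex k l) (ij' : mindex k' l') :
  (forall u, label ij' (h u) = label ij u) ->
  image_part hbij (ker ij.1 ij.2) = ker ij'.1 ij'.2.
Proof.
move=> lab; set p := ker ij.1 ij.2.
have [/eqP covp _ _] := and3P (valP p).
have [_ trh _] := and3P (valP (image_part hbij p)).
have hinj := bij_inj hbij.
apply: part_ext => u' v'; have [g _ gK] := hbij.
rewrite same_block_ker -(gK u') -(gK v') !lab -same_block_ker.
rewrite {1}/same_block (@def_pblock _ _ (h @: pblock (val p) (g u'))) //.
- by rewrite mem_imset.
- by apply: imset_f; rewrite pblock_mem // covp finset.in_setT.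
by rewrite mem_imset // mem_pblock covp finset.in_setT.
Qed.

Lemma ker_ind k l (p : part k l) : ker (ind p).1 (ind p).2 = p.
Proof. by have [] := indP p. Qed.

(** * Extending renamings to finitary permutations *)

Lemma is_Sinf_id : is_Sinf id.
Proof.
split; first by exists id.
by apply: (@sub_finite_set _ _ classical_sets.set0) => // n /=.
Qed.

Lemma is_Sinf_comp s t : is_Sinf s -> is_Sinf t -> is_Sinf (fun n => s (t n)).
Proof.
move=> [bs fs] [bt ft]; split; first exact: (@bij_comp _ _ _ s t).
apply: (@sub_finite_set _ _
  ([set n | s n <> n] `|` [set n | t n <> n])%classic); last first.
  by rewrite finite_setU.
move=> n /= stn; have [tn|] := pselect (t n = n); last by right.
by left=> /=; rewrite tn in stn.
Qed.

Definition swap (x y n : nat) : nat :=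
  if n == x then y else if n == y then x else n.

Lemma is_Sinf_swap x y : is_Sinf (swap x y).
Proof.
have K : involutive (swap x y).
  move=> n; rewrite /swap; case: (eqVneq n x) => [->|nx].
    by rewrite eqxx; case: eqVneq => [->|].
  case: (eqVneq n y) => [->|ny]; first by rewrite eqxx.
  by rewrite (negPf nx) (negPf ny).
split; first exact: inv_bij.
apply: (@sub_finite_set _ _ ([set x] `|` [set y])%classic); last first.
  by rewrite finite_setU; split; apply: finite_set1.
move=> n /=; rewrite /swap; case: eqVneq => [->|_]; first by left.
by case: eqVneq => [->|_] //; right.
Qed.

(** Corrects the permutation one letter at a time: if t agrees with f on s, then
    composing with the transposition of t x and f x repairs the value at x, and
    leaves the values on s alone because f is injective on x :: s. *)
Lemma Sinf_extend (f : nat -> nat) (s : seq nat) :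
  {in s &, injective f} -> exists2 t, is_Sinf t & {in s, t =1 f}.
Proof.
elim: s => [|x s IHs] finj.
  by exists id => //; apply: is_Sinf_id.
have [|t tS tf] := IHs.
  by apply: sub_in2 finj => y ys; rewrite inE ys orbT.
have [xs|xNs] := boolP (x \in s).
  by exists t => // y; rewrite inE => /predU1P [->|]; apply: tf.
exists (fun n => swap (t x) (f x) (t n)).
  exact: is_Sinf_comp (is_Sinf_swap _ _) tS.
move=> y; rewrite inE /swap => /predU1P [->|ys]; first by rewrite eqxx.
have xy : y != x by apply: contraNneq xNs => <-.
rewrite (inj_eq (bij_inj tS.1)) (negPf xy) tf //.
case: eqP => // fyx; case/eqP: xy; apply: finj => //.
  by rewrite inE ys orbT.
by rewrite inE eqxx.
Qed.

(** * Orbits of labellings *)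

Lemma label_relabel s k l (ij : mindex k l) u :
  label (relabel s ij) u = s (label ij u).
Proof. by case: u => x /=; rewrite tnth_map. Qed.

Lemma label_inj k l (ij ij' : mindex k l) : label ij =1 label ij' -> ij = ij'.
Proof.
case: ij ij' => i j [i' j'] e; congr pair; apply: eq_from_tnth => x.
  exact: (e (inl x)).
exact: (e (inr x)).
Qed.

Lemma ker_relabel (f : nat -> nat) k l (ij : mindex k l) :
  {in codom (label ij) &, injective f} ->
  ker (relabel f ij).1 (relabel f ij).2 = ker ij.1 ij.2.
Proof.
move=> finj; apply/ker_eqP => u v; rewrite !label_relabel.
by apply/eqP/eqP => [/finj->|->] //; apply: codom_f.
Qed.

(** Two labellings with the same kernel differ by an injection between their
    finite sets of labels, which extends to a finitary permutation. *)
Lemma mindex_orbitE k l (ij ij' : mindex k l) :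
  mindex_orbit ij ij' <-> ker ij'.1 ij'.2 = ker ij.1 ij.2.
Proof.
split=> [[s [bs _] ->]|/ker_eqP e].
  by apply: ker_relabel => ? ? _ _; apply: bij_inj bs _ _.
pose f n := if [pick u | label ij u == n] is Some u then label ij' u else 0.
have fE u : f (label ij u) = label ij' u.
  rewrite /f; case: pickP => [v|/(_ u)]; last by rewrite eqxx.
  by rewrite -e => /eqP.
have [|s sS sf] := @Sinf_extend f (codom (label ij)).
  move=> _ _ /codomP [u ->] /codomP [v ->]; rewrite !fE => /eqP.
  by rewrite e => /eqP.
exists s => //; apply: label_inj => u.
by rewrite label_relabel sf ?codom_f ?fE.
Qed.

Lemma mindex_orbit_ind k l (p : part k l) (ij : mindex k l) :
  mindex_orbit (ind p) ij <-> ker ij.1 ij.2 = p.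
Proof. by rewrite mindex_orbitE ker_ind. Qed.

(** * Involution and conditioned composition on labellings *)

Lemma invol_ker k l (i : k.-tuple nat) (j : l.-tuple nat) :
  invol (ker i j) = ker j i.
Proof. by apply: (image_part_ker _ (ij := (i, j)) (ij' := (j, i))); case. Qed.

Lemma connect_invariant (T : finType) (A : Type) (e : rel T) (f : T -> A) :
  (forall x y, e x y -> f x = f y) -> forall x y, connect e x y -> f x = f y.
Proof.
move=> ef x y /connectP [s]; elim: s x => [x _ -> //|z s IHs x /= /andP [exz]].
by rewrite (ef _ _ exz); apply: IHs.
Qed.

Definition stack_label k l m (i : k.-tuple nat) (j : l.-tuple nat)
    (n : m.-tuple nat) (w : stack k l m) : nat :=
  match w with inl u => label (i, j) u | inr z => tnth n z end.

(** Without the hypothesis, an upper and a lower point could carry the same label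
    by coincidence, with no path through the middle row joining them. *)
Lemma comp_ker k l m (i : k.-tuple nat) (j : l.-tuple nat) (n : m.-tuple nat) :
  (forall a, a \in i -> a \in n -> a \in j) ->
  Defs.comp (ker i j) (ker j n) = ker i n.
Proof.
move=> ijn; pose p := ker i j; pose q := ker j n.
have csym := sym_connect_sym (stack_edge_sym p q).
have top u v : label (i, j) u = label (i, j) v ->
    connect (stack_edge p q) (stack_top m u) (stack_top m v).
  move=> uv; apply: connect1; apply/orP; left.
  apply/existsP; exists u; apply/existsP; exists v; rewrite !eqxx.
  by rewrite (same_block_ker (i, j)) uv eqxx.
have bot u v : label (j, n) u = label (j, n) v ->
    connect (stack_edge p q) (stack_bot k u) (stack_bot k v).
  move=> uv; apply: connect1; apply/orP; right.
  apply/existsP; exists u; apply/existsP; exists v; rewrite !eqxx.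
  by rewrite (same_block_ker (j, n)) uv eqxx.
have mid x z : tnth i x = tnth n z ->
    connect (stack_edge p q) (inl (inl x)) (inr z).
  move=> xz; have /tnthP [y jy] : tnth i x \in j.
    by apply: ijn; rewrite ?mem_tnth // xz mem_tnth.
  apply: (@connect_trans _ _ (inl (inr y))).
    exact: (top (inl x) (inr y)).
  by apply: (bot (inl y) (inr z)); rewrite /= -jy.
apply: part_ext => u v; rewrite (same_block_ker (i, n)).
rewrite {1}/same_block /= pblock_equivalence_partition ?inE //; last first.
  exact: comp_rel_equiv.
rewrite /comp_rel -/p -/q; apply/idP/eqP.
  have labE w : label (i, n) w = stack_label i j n (stack_outer l w) by case: w.
  rewrite !labE; apply: connect_invariant => w w' /orP [] /existsP [x]
    /existsP [y] /and3P [].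
    by rewrite (same_block_ker (i, j)) => /eqP xy /eqP <- /eqP <-.
  rewrite (same_block_ker (j, n)) => /eqP xy /eqP <- /eqP <-.
  by case: x y xy => x [] y.
case: u v => x [] y /= xy.
- exact: (top (inl x) (inl y)).
- exact: mid.
- by rewrite csym; apply: mid.
- exact: (bot (inr x) (inr y)).
Qed.

(** The minimal labellings restrict on the middle row to labellings with the same
    kernel, hence in the same orbit. *)
Lemma compatible_ker k l m (i : k.-tuple nat) (j : l.-tuple nat)
    (n : m.-tuple nat) : compatible (ker i j) (ker j n).
Proof.
have /ker_eqP ep := ker_ind (ker i j) : _ = ker (i, j).1 (i, j).2.
have /ker_eqP eq := ker_ind (ker j n) : _ = ker (j, n).1 (j, n).2.
have [s sS [es]] :
    mindex_orbit ((ind (ker j n)).1, [tuple]) ((ind (ker i j)).2, [tuple]).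
  apply/mindex_orbitE/ker_eqP => -[u|[] //] [v|[] //] /=.
  by rewrite (ep (inr u) (inr v)) (eq (inl u) (inl v)).
by exists s => //; apply: val_inj.
Qed.

(** The labels of q are transported so that the two labellings of the middle row
    coincide; the remaining labels of q are then pushed beyond all those of p. *)
Lemma compatible_labels k l m (p : part k l) (q : part l m) :
  compatible p q -> exists i j n,
    [/\ p = ker i j, q = ker j n & forall a, a \in i -> a \in n -> a \in j].
Proof.
case ep: (ind p) => [i j]; case eq: (ind q) => [j' n'] [s [bs _]].
rewrite /= ep eq /= => ej.
have pE : p = ker i j by rewrite -[p]ker_ind ep.
pose n := map_tuple s n'.
have qE : q = ker j n.
  rewrite -[q]ker_ind eq ej; symmetry; apply: (@ker_relabel s _ _ (j', n')).
  by move=> ? ? _ _; apply: bij_inj.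
pose M := (\max_(a <- i ++ j) a).+1.
have ltM a : a \in i ++ j -> a < M.
  by move=> aij; rewrite ltnS (big_rem a) //= leq_maxl.
pose f a := if a \in j then a else a + M.
have fj a : a \in j -> f a = a by rewrite /f => ->.
have fNj a : a \notin j -> f a \notin i ++ j.
  move=> aNj; rewrite /f (negPf aNj); apply: contraL (leq_addl a M) => /ltM.
  by rewrite ltnNge.
have f_inj : injective f.
  move=> a b; have [aj|aNj] := boolP (a \in j); have [bj|bNj] := boolP (b \in j).
  - by rewrite !fj.
  - move=> fab; have := fNj b bNj.
    by rewrite -fab fj // mem_cat aj orbT.
  - move=> fab; have := fNj a aNj.
    by rewrite fab fj // mem_cat bj orbT.
  - by rewrite /f (negPf aNj) (negPf bNj) => /addIn.
exists i, j, (map_tuple f n); split=> // [|a ai /mapP [b _ ab]].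
  have ef : relabel f (j, n) = (j, map_tuple f n).
    by congr pair; apply: val_inj; apply: map_id_in => c /fj.
  rewrite qE -[RHS]/(ker (j, map_tuple f n).1 (j, map_tuple f n).2) -ef.
  by symmetry; apply: (@ker_relabel f _ _ (j, n)) => ? ? _ _; apply: f_inj.
move: ai; rewrite ab; have [bj|/fNj] := boolP (b \in j); first by rewrite fj.
by rewrite mem_cat => /norP [/negPf->].
Qed.

(** * Rotations and the boundary word *)

Lemma tuple_rconsP n T (P : n.+1.-tuple T -> Prop) :
  (forall (t : n.-tuple T) a, P [tuple of rcons t a]) -> forall t, P t.
Proof.
move=> Prcons t; case/lastP eqt: (val t) (size_tuple t) => [//|s a].
rewrite size_rcons => /eq_add_S /eqP ss.
by rewrite (_ : t = [tuple of rcons (Tuple ss) a]) //; apply: val_inj.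
Qed.

Lemma tnth_rcons_lift n T (t : n.-tuple T) a (x : 'I_n) :
  tnth [tuple of rcons t a] (lift ord_max x) = tnth t x.
Proof.
rewrite !(tnth_nth a) /= nth_rcons size_tuple.
by rewrite (_ : bump n x = x) ?ltn_ord // /bump leqNgt ltn_ord.
Qed.

Lemma tnth_rcons_max n T (t : n.-tuple T) a :
  tnth [tuple of rcons t a] ord_max = a.
Proof. by rewrite (tnth_nth a) /= nth_rcons size_tuple ltnn eqxx. Qed.

Section RotationKer.
Variables (k l : nat) (a : nat) (i : k.-tuple nat) (j : l.-tuple nat).

Lemma down_left_ker :
  image_part (down_bij (@ord0 k) (@ord0 l)) (ker [tuple of a :: i] j) =
  ker i [tuple of a :: j].
Proof.
apply: (image_part_ker _ (ij := (_, _)) (ij' := (_, _))) => -[x|y] /=.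
  by case: unliftP => [x'|] ->; rewrite /= ?tnthS ?tnth0.
by rewrite tnthS.
Qed.

Lemma up_left_ker :
  image_part (up_bij (@ord0 k) (@ord0 l)) (ker i [tuple of a :: j]) =
  ker [tuple of a :: i] j.
Proof.
apply: (image_part_ker _ (ij := (_, _)) (ij' := (_, _))) => -[x|y] /=.
  by rewrite tnthS.
by case: unliftP => [x'|] ->; rewrite /= ?tnthS ?tnth0.
Qed.

Lemma down_right_ker :
  image_part (down_bij (@ord_max k) (@ord_max l)) (ker [tuple of rcons i a] j) =
  ker i [tuple of rcons j a].
Proof.
apply: (image_part_ker _ (ij := (_, _)) (ij' := (_, _))) => -[x|y] /=.
  by case: unliftP => [x'|] ->; rewrite /= ?tnth_rcons_lift ?tnth_rcons_max.
by rewrite tnth_rcons_lift.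
Qed.

Lemma up_right_ker :
  image_part (up_bij (@ord_max k) (@ord_max l)) (ker i [tuple of rcons j a]) =
  ker [tuple of rcons i a] j.
Proof.
apply: (image_part_ker _ (ij := (_, _)) (ij' := (_, _))) => -[x|y] /=.
  by rewrite tnth_rcons_lift.
by case: unliftP => [x'|] ->; rewrite /= ?tnth_rcons_lift ?tnth_rcons_max.
Qed.

End RotationKer.

(** The labels of ker(i, j) in cyclic order: the lower row from right to left,
    then the upper row from left to right. *)
Definition boundary (i j : seq nat) : seq nat := rev j ++ i.

(** The boundary word starts at the right end of the lower row and stops at the
    right end of the upper row.  So moving a point at the left end does not change
    it, and moving one at the right end carries a letter from one end of the word
    to the other. *)
Lemma basic_rotation_boundary k l (p : part k l) k' l' (r : part k' l') :
  basic_rotation p r -> forall (i : k.-tuple nat) (j : l.-tuple nat),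
  p = ker i j -> exists (i' : k'.-tuple nat) (j' : l'.-tuple nat),
    r = ker i' j' /\ exists n, boundary i' j' = rot n (boundary i j).
Proof.
rewrite /boundary; case=> {k l p k' l' r} k l p i j ->{p}.
- case/tupleP: i => a i; rewrite down_left_ker; exists i, [tuple of a :: j].
  by split=> //; exists 0; rewrite rot0 /= rev_cons cat_rcons.
- case/tupleP: j => a j; rewrite up_left_ker; exists [tuple of a :: i], j.
  by split=> //; exists 0; rewrite rot0 /= rev_cons cat_rcons.
- elim/tuple_rconsP: i => i a; rewrite down_right_ker.
  exists i, [tuple of rcons j a]; split=> //; exists (size (rev j ++ i)).
  by rewrite /= -[rcons i a]cats1 catA rot_size_cat rev_rcons.
- elim/tuple_rconsP: j => j a; rewrite up_right_ker.
  exists [tuple of rcons i a], j; split=> //; exists 1.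
  by rewrite /= rev_rcons /= rot1_cons rcons_cat.
Qed.

(** Stated for an arbitrary property of words because it serves to track
    membership in a subgroup along a chain of rotations. *)
Lemma rotation_boundary (L : seq nat -> Prop) :
  (forall n w, L w -> L (rot n w)) ->
  forall k l (p : part k l) k' l' (r : part k' l'), rotation p r ->
  (forall i j, p = ker i j -> L (boundary i j)) ->
  exists i j, r = ker i j /\ L (boundary i j).
Proof.
move=> Lrot k l p k' l' r + Lp.
elim=> {k' l' r} [|k1 l1 q k2 l2 r _ [i [j [-> Lij]]] qr].
  by exists (ind p).1, (ind p).2; split; [|apply: Lp]; rewrite ker_ind.
have [i' [j' [-> [n e]]]] := basic_rotation_boundary qr (erefl _).
by exists i', j'; split=> //; rewrite e; apply: Lrot.
Qed.

Lemma rotation1 k l (p : part k l) k' l' (r : part k' l') :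
  basic_rotation p r -> rotation p r.
Proof. by apply: Rotation_step; apply: Rotation_refl. Qed.

Lemma rotation_trans k l (p : part k l) k' l' (q : part k' l') k'' l''
    (r : part k'' l'') : rotation p q -> rotation q r -> rotation p r.
Proof.
move=> pq; elim=> {k'' l'' r} // k1 l1 q1 k2 l2 r _ IH.
exact: Rotation_step.
Qed.

(** Moving the lower points one by one to the left end of the upper row reverses
    their order, and produces the boundary word on a single row.  The length of
    the row is a free variable n, equal to l + k only propositionally. *)
Lemma rotation_straighten k l (i : k.-tuple nat) (j : l.-tuple nat) n
    (t : n.-tuple nat) : val t = boundary i j ->
  rotation (ker i j) (ker t [tuple]) /\ rotation (ker t [tuple]) (ker i j).
Proof.
elim: l => [|l IHl] in k i j *.
  rewrite (tuple0 j) /boundary /= => eti.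
  have enk : n = k by rewrite -(size_tuple t) eti size_tuple.
  case: _ / enk in i eti *; rewrite (val_inj eti : t = i).
  by split; apply: Rotation_refl.
case/tupleP: j => a j; rewrite /boundary /= rev_cons cat_rcons => et.
have [to_t of_t] := IHl _ [tuple of a :: i] j et.
split.
  apply: rotation_trans to_t; apply: rotation1.
  by rewrite -up_left_ker; apply: Rot_up_left.
by apply: Rotation_step of_t _; rewrite -down_left_ker; apply: Rot_down_left.
Qed.

(** * From invariant normal subgroups to skew categories *)

Lemma aword_cat u v : aword (u ++ v) = (aword u * aword v)%g.
Proof. by rewrite -Z2mulE. Qed.

Lemma aword_rev u : aword (rev u) = ((aword u)^-1)%g.
Proof. by rewrite -Z2invE. Qed.

Lemma aword_boundary i j : aword (boundary i j) = ((aword j)^-1 * aword i)%g.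
Proof. by rewrite aword_cat aword_rev. Qed.

(** Membership of a rotation can be read off any labelling: cyclic shifts of a
    word conjugate its element, and N is stable under conjugation and renaming. *)
Lemma rotations_of_kerE (N : set Z2free) :
  normal_subgroup N -> Sinvariant N ->
  forall k l (i : k.-tuple nat) (j : l.-tuple nat),
  rotations_of N k l (ker i j) <-> N (aword (boundary i j)).
Proof.
move=> [_ Nconj] NS.
have Nker k l (i i' : k.-tuple nat) (j j' : l.-tuple nat) :
    ker i j = ker i' j' ->
    N (aword (boundary i j)) -> N (aword (boundary i' j')).
  move=> e; have [s sS [-> ->]] : mindex_orbit (i, j) (i', j').
    exact/mindex_orbitE.
  by rewrite /boundary /= -map_rev -map_cat -Sact_aword; apply: NS.
have Nrot n w : N (aword w) -> N (aword (rot n w)).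
  rewrite -{1}(cat_take_drop n w) => /(Nconj _ (aword (take n w))).
  by rewrite aword_cat aword_cat /conjg mulgA mulKg.
move=> k l i j; split=> [[n [t [Nt rt]]]|Nij].
  have [t' i' e|i' [j' [e]]] := rotation_boundary Nrot rt.
    by apply: Nker e _; rewrite /boundary /=.
  exact/Nker.
exists (size (boundary i j)), (in_tuple (boundary i j)); split=> //.
have et : val (in_tuple (boundary i j)) = boundary i j by [].
by have [] := rotation_straighten et.
Qed.

Lemma rotations_of_skew (N : set Z2free) :
  normal_subgroup N -> Sinvariant N -> skew_category (rotations_of N).
Proof.
move=> Nnormal NS; have NP := rotations_of_kerE Nnormal NS.
have [Ngrp Nconj] := Nnormal.
have N1 : N 1%g by have [/set_mem] := Ngrp.
have NM (x y : Z2free) : N x -> N y -> N (x * y)%g.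
  move=> /mem_set Nx /mem_set Ny; apply: set_mem.
  exact: (group_closedM Ngrp).
have NV (x : Z2free) : N x -> N (x^-1)%g.
  by move=> /mem_set Nx; apply: set_mem; apply: (group_closedV Ngrp).
split.
- have e11 : aword [:: 1; 1] = 1%g by apply/awordP/Word_square.
  by split; apply/NP; rewrite /boundary /= e11.
- move=> k l p; rewrite -(ker_ind p) invol_ker => /NP /NV.
  by rewrite aword_boundary invgM invgK -aword_boundary => /NP.
- move=> k l k' l' p q r Rp Rq [[i j] [[f g] [/mindex_orbit_ind ep]]].
  move=> /mindex_orbit_ind eq ->; rewrite -ep -eq in Rp Rq.
  move/NP: Rp => /= /(Nconj _ (aword g)) Np; move/NP: Rq => /= Nq; apply/NP.
  have := NM _ _ Np Nq; rewrite !aword_boundary !aword_cat invgM /conjg.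
  by rewrite !mulgA mulgK.
move=> k l m p q Rp Rq /compatible_labels [i [j [n [ep eq ijn]]]].
rewrite ep eq in Rp Rq *; rewrite comp_ker //; apply/NP.
move/NP: Rp => /(NM _ _ ((NP _ _ _ _).1 Rq)).
by rewrite !aword_boundary mulgA mulgK.
Qed.

(** * From skew categories to invariant normal subgroups *)

Section SkewCategory.
Variable R : partset.
Arguments R : clear implicits.
Hypothesis Rrot : rotation_closed R.

Definition row_word (w : seq nat) : Prop :=
  R (size w) 0 (ker (in_tuple w) [tuple]).

Lemma rotation_closed_kerE k l (i : k.-tuple nat) (j : l.-tuple nat) :
  R k l (ker i j) <-> row_word (boundary i j).
Proof.
have et : val (in_tuple (boundary i j)) = boundary i j by [].
have [to_row of_row] := rotation_straighten et.
by split=> [/Rrot|/Rrot]; apply.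
Qed.

Lemma row_wordE n (t : n.-tuple nat) : row_word t <-> R n 0 (ker t [tuple]).
Proof. by split=> [Rt|/rotation_closed_kerE //]; apply/rotation_closed_kerE. Qed.

Lemma row_word_rot1 a w : row_word (a :: w) -> row_word (rcons w a).
Proof.
move=> Raw.
have Rwa : R (size w) 1 (ker (in_tuple w) [tuple a]).
  exact/rotation_closed_kerE.
apply/(@row_wordE _ [tuple of rcons (in_tuple w) a])/(Rrot Rwa)/rotation1.
have -> : [tuple a] = [tuple of rcons [tuple] a] by apply: val_inj.
by rewrite -up_right_ker; apply: Rot_up_right.
Qed.

Lemma row_word_swap u v : row_word (u ++ v) -> row_word (v ++ u).
Proof.
elim: u v => [|a u IHu] v; first by rewrite cats0.
move=> Rauv; rewrite -cat_rcons; apply: IHu.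
by rewrite -rcons_cat; apply: row_word_rot1.
Qed.

Lemma Finf_row_word x : Finf R x <-> exists2 w, row_word w & x = aword w.
Proof.
split=> [[s sS [_ [k [p [Rp ->]]] ->]]|[w Rw ->]].
  exists (map s (ind p).1); last exact: Sact_aword.
  apply/(@row_wordE _ [tuple of map s (ind p).1]).
  suff <- : p = ker [tuple of map s (ind p).1] [tuple] by [].
  symmetry; apply/(mindex_orbit_ind p (_, _)).
  exists s => //; rewrite /relabel [map_tuple s (ind p).2]tuple0.
  by congr pair; apply: val_inj.
pose p := ker (in_tuple w) [tuple].
have [s sS [e]] : mindex_orbit (ind p) (in_tuple w, [tuple]).
  exact/mindex_orbit_ind.
exists s => //; exists (aword (ind p).1); first by exists (size w), p.
by rewrite Sact_aword {1}e.
Qed.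

Hypothesis Rskew : skew_category R.

Lemma row_word_cat u v : row_word u -> row_word v -> row_word (u ++ v).
Proof.
have [_ _ Rtensor _] := Rskew; move=> Ru Rv.
apply/(@row_wordE _ (cat_tuple (in_tuple u) (in_tuple v))).
apply: (Rtensor _ _ _ _ _ _ _ Ru Rv).
exists (in_tuple u, [tuple]), (in_tuple v, [tuple]).
by split; [exact/mindex_orbit_ind.. | congr ker; apply: val_inj].
Qed.

Lemma row_word_rev u : row_word u -> row_word (rev u).
Proof.
have [_ Rinv _ _] := Rskew; move=> /Rinv.
by rewrite invol_ker => /rotation_closed_kerE; rewrite /boundary cats0.
Qed.

Lemma row_word_square a : row_word [:: a; a].
Proof.
have [[Rcup _] _ _ _] := Rskew; apply/(@row_wordE _ [tuple a; a]).
rewrite (_ : ker _ _ = pcup) //.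
apply/(ker_eqP ([tuple a; a], [tuple]) ([tuple 1; 1], [tuple])).
move=> [x|[] //] [y|[] //] /=.
rewrite !(tnth_nth 0) /=.
by case: x y => [[|[|[]]]] // ? [[|[|[]]]] //=; rewrite !eqxx.
Qed.

Lemma row_word_comp k l m (i : k.-tuple nat) (j : l.-tuple nat)
    (n : m.-tuple nat) :
  (forall a, a \in i -> a \in n -> a \in j) ->
  row_word (boundary i j) -> row_word (boundary j n) -> row_word (boundary i n).
Proof.
have [_ _ _ Rcomp] := Rskew; move=> ijn.
move=> /(rotation_closed_kerE i j) Rij /(rotation_closed_kerE j n) Rjn.
apply/(rotation_closed_kerE i n); rewrite -(comp_ker ijn).
exact: Rcomp Rij Rjn (compatible_ker _ _ _).
Qed.

(** The pair partition turned upside-down and composed with the pair partition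
    closes up to the empty partition. *)
Lemma row_word_nil : row_word [::].
Proof.
have Raa := row_word_square 0.
exact: (@row_word_comp _ _ _ [tuple] [tuple 0; 0] [tuple]).
Qed.

(** Cyclic shifts bring the point of insertion to the end of the word, where the
    pair partition is attached by a tensor product. *)
Lemma row_word_insert a u v :
  row_word (u ++ v) -> row_word (u ++ [:: a; a] ++ v).
Proof.
move=> /row_word_swap Rvu; rewrite catA; apply: row_word_swap; rewrite catA.
by apply: row_word_cat => //; apply: row_word_square.
Qed.

Lemma row_word_rev_cat w : row_word (rev w ++ w).
Proof.
elim: w => [|a w IHw]; first exact: row_word_nil.
by rewrite rev_cons cat_rcons; apply: (row_word_insert a IHw).
Qed.

(** After a cyclic shift the square is at the end, in w ++ aa.  Put p = ker(w aa)
    turned into a lower row, above q = ker(aa r, r) with r = rev w: the composition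
    forgets aa and leaves ker(w), turned into a lower row.  The boundary word
    rev r ++ aa ++ r of q is a palindrome with a square inserted. *)
Lemma row_word_delete a u v :
  row_word (u ++ [:: a; a] ++ v) -> row_word (u ++ v).
Proof.
rewrite catA => /row_word_swap; rewrite catA => Rvu.
apply: row_word_swap; set w := v ++ u in Rvu *.
pose r := in_tuple (rev w); pose j := [tuple of [:: a, a & r]].
have -> : w = boundary [tuple] r by rewrite /boundary /= revK cats0.
apply: (@row_word_comp _ _ _ [tuple] j r) => //.
  by rewrite /boundary /= !rev_cons revK -!cats1 cats0 -catA.
rewrite /boundary /=; apply: (row_word_insert a (u := rev (rev w))).
exact: row_word_rev_cat.
Qed.

(** Quantifying over contexts x _ y makes the induction on [word_eq] go through
    its congruence rule. *)
Lemma row_word_eq u v : word_eq u v -> row_word u <-> row_word v.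
Proof.
suff H : word_eq u v -> forall x y,
    row_word (x ++ u ++ y) <-> row_word (x ++ v ++ y).
  by move=> /H /(_ [::] [::]); rewrite !cats0.
elim=> {u v} [a|u u' v v' _ IHu _ IHv|u|u v _ IH|u v w _ IHuv _ IHvw] x y //.
- by split; [apply: row_word_delete|apply: row_word_insert].
- by rewrite -!catA IHu 2!(catA x) IHv.
- by rewrite IH.
- by rewrite IHuv.
Qed.

Lemma Finf_aword w : Finf R (aword w) <-> row_word w.
Proof.
split=> [/Finf_row_word [v Rv /awordP wv]|Rw]; last first.
  by apply/Finf_row_word; exists w.
exact/(row_word_eq wv).
Qed.

Lemma Finf_normal : normal_subgroup (Finf R).
Proof.
split; [split|].
- by apply/mem_set/Finf_aword/row_word_nil.
- move=> x y; rewrite -(awordK x) -(awordK y).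
  move=> /set_mem /Finf_aword Rx /set_mem /Finf_aword Ry; apply/mem_set.
  rewrite -aword_rev -aword_cat; apply/Finf_aword.
  exact/row_word_cat/row_word_rev.
move=> x y; rewrite -(awordK x) -(awordK y); set u := repr x; set v := repr y.
have -> : (aword u ^ aword v)%g = aword (rev v ++ u ++ v).
  by rewrite !aword_cat aword_rev.
move=> /Finf_aword Ru; apply/Finf_aword.
apply: (@row_word_swap (u ++ v) (rev v)); rewrite -catA.
apply: row_word_cat => //.
by have := row_word_rev_cat (rev v); rewrite revK.
Qed.

Lemma Finf_Sinvariant : Sinvariant (Finf R).
Proof.
move=> t x tS [s sS [y Fy ->]]; exists (fun n => t (s n)).
  exact: is_Sinf_comp.
by exists y => //; rewrite Sact_aword -map_comp.
Qed.

Lemma skew_rotations_of k l : R k l = rotations_of (Finf R) k l.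
Proof.
apply/funext => p; apply/propext; rewrite -(ker_ind p).
rewrite rotations_of_kerE; [|exact: Finf_normal|exact: Finf_Sinvariant].
by rewrite Finf_aword rotation_closed_kerE.
Qed.

End SkewCategory.

Theorem theorem2p3 :
  (forall R : partset, rotation_closed R ->
     (skew_category R <->
        [/\ normal_subgroup (Finf R), Sinvariant (Finf R)
          & forall k l : nat, R k l = rotations_of (Finf R) k l])) /\
  (forall N : set Z2free, normal_subgroup N -> Sinvariant N ->
     skew_category (rotations_of N)).
Proof.
split=> [R Rrot|]; last exact: rotations_of_skew.
split=> [Rskew|[Nnormal NS Req]].
  split; [exact: Finf_normal|exact: Finf_Sinvariant|exact: skew_rotations_of].
rewrite (_ : R = rotations_of (Finf R)); first exact: rotations_of_skew.
apply/functional_extensionality_dep => k.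
by apply/functional_extensionality_dep => l.
Qed.
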